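(* Let $(X,\mathcal{B},{\bf b})$ be a coarse proximity space and let $\phi$ be the corresponding weak asymptotic resemblance. If $A,B\subseteq X$, then $A\,\phi\,B$ if and only if $tr(A)=tr(B)$, where $tr(A)=cl_{\mathfrak{X}}(A)\cap\mathcal{U}X$ denotes the trace of $A$ in the boundary $\mathcal{U}X$.
   Context: Coarse proximity spaces. A bornology $\mathcal{B}$ on a set $X$ is a family of subsets containing all singletons and closed under subsets and finite unions; its members are called bounded, other subsets unbounded. A coarse proximity on $(X,\mathcal{B})$ is a relation ${\bf b}$ on the power set of $X$ such that for all $A,B,C\subseteq X$: (1) $A{\bf b}B\Rightarrow B{\bf b}A$; (2) $A{\bf b}B\Rightarrow A,B\notin\mathcal{B}$; (3) $A\cap B\notin\mathcal{B}\Rightarrow A{\bf b}B$; (4) $(A\cup B){\bf b}C\iff A{\bf b}C$ or $B{\bf b}C$; (5) $A\bar{\bf b}B\Rightarrow\exists E\subseteq X$ with $A\bar{\bf b}E$ and $(X\setminus E)\bar{\bf b}B$ (a bar denotes negation). Then $(X,\mathcal{B},{\bf b})$ is a coarse proximity space. The weak asymptotic resemblance $\phi$ induced by ${\bf b}$ is the relation on subsets of $X$: $A\phi B$ iff $A{\bf b}B'$ for every unbounded $B'\subseteq B$ and $A'{\bf b}B$ for every unbounded $A'\subseteq A$. Proximities and clusters. A proximity on a set $X$ is a relation $\delta$ on the power set with: (1) $A\delta B\Rightarrow B\delta A$; (2) $A\delta B\Rightarrow A,B\ne\emptyset$; (3) $A\cap B\neq\emptyset\Rightarrow A\delta B$;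 (4) $A\delta(B\cup C)\iff A\delta B$ or $A\delta C$; (5) $A\bar\delta B\Rightarrow\exists E\subseteq X$ with $A\bar\delta E$ and $(X\setminus E)\bar\delta B$. It is separated if $\{x\}\delta\{y\}\iff x=y$. It induces the topology in which $A$ is closed iff ($A\delta\{x\}\Rightarrow x\in A$). A cluster in $(X,\delta)$ is a collection $\sigma$ of subsets of $X$ such that: $A,B\in\sigma\Rightarrow A\delta B$; if $A\delta B$ for all $B\in\sigma$ then $A\in\sigma$; if $A\cup B\in\sigma$ then $A\in\sigma$ or $B\in\sigma$. For $\delta$ separated, the Smirnov compactification $\mathfrak{X}$ is the set of all clusters with the proximity $\mathcal{A}\delta^*\mathcal{C}$ iff $A\delta C$ for all $A,C\subseteq X$ such that $A\in\sigma$ for all $\sigma\in\mathcal{A}$ and $C\in\sigma$ for all $\sigma\in\mathcal{C}$; it is compact Hausdorff, and $X$ is identified with a dense subset of $\mathfrak{X}$ via $x\mapsto\sigma_x$, the unique cluster containing $\{x\}$. For $A\subseteq X$, $cl_{\mathfrak{X}}(A)=\{\sigma\in\mathfrak{X}\mid A\in\sigma\}$. Boundary. The discrete extension of ${\bf b}$ is the separated proximity $A\delta_{dis}B\iff A\cap B\ne\emptyset$ or $A{\bf b}B$. Here $\mathfrak{X}$ is the Smirnov compactification of $(X,\delta_{dis})$, and $\mathcal{U}X\subseteq\mathfrak{X}$ is the set of clusters in $(X,\delta_{dis})$ containing no bounded set. *)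

(* Defs.v *)
From mathcomp Require Import all_boot.
From mathcomp Require Import boolp classical_sets.
Set Implicit Arguments.
Unset Strict Implicit.
Unset Printing Implicit Defensive.
Local Open Scope classical_set_scope.

(* [bounded_set0] is the empty union; it follows from the other fields unless
   [X] is empty. *)
Record bornology (X : Type) := Bornology {
  bounded :> set X -> Prop;
  bounded_set0 : bounded set0;
  bounded_set1 : forall x, bounded [set x];
  bounded_sub : forall A B, A `<=` B -> bounded B -> bounded A;
  bounded_setU : forall A B, bounded A -> bounded B -> bounded (A `|` B) }.

Record coarse_proximity (X : Type) (Bd : bornology X) := CoarseProximity {
  coarse_near :> set X -> set X -> Prop;
  coarse_sym : forall A B, coarse_near A B -> coarse_near B A;
  coarse_unbounded : forall A B, coarse_near A B -> ~ Bd A /\ ~ Bd B;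
  coarse_setI : forall A B, ~ Bd (A `&` B) -> coarse_near A B;
  coarse_setU : forall A B C,
    coarse_near (A `|` B) C <-> coarse_near A C \/ coarse_near B C;
  coarse_strong : forall A B, ~ coarse_near A B ->
    exists E, ~ coarse_near A E /\ ~ coarse_near (~` E) B }.

Definition weak_asymptotic_resemblance (X : Type) (Bd : bornology X)
    (b : coarse_proximity Bd) (A B : set X) : Prop :=
  (forall B', B' `<=` B -> ~ Bd B' -> b A B') /\
  (forall A', A' `<=` A -> ~ Bd A' -> b A' B).

Record proximity (X : Type) := Proximity {
  prox_near :> set X -> set X -> Prop;
  near_sym : forall A B, prox_near A B -> prox_near B A;
  near_neq0 : forall A B, prox_near A B -> A <> set0 /\ B <> set0;
  near_setI : forall A B, A `&` B <> set0 -> prox_near A B;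
  near_setU : forall A B C,
    prox_near A (B `|` C) <-> prox_near A B \/ prox_near A C;
  near_strong : forall A B, ~ prox_near A B ->
    exists E, ~ prox_near A E /\ ~ prox_near (~` E) B }.

Definition separated (X : Type) (d : proximity X) : Prop :=
  forall x y, d [set x] [set y] <-> x = y.

(* The topology induced by a proximity, given by its closed sets. Only the
   underlying relation matters, so that these apply directly to
   [smirnov_near] below. *)
Definition near_closed (T : Type) (d : set T -> set T -> Prop) (F : set T)
    : Prop :=
  forall x, d F [set x] -> F x.

Definition near_closure (T : Type) (d : set T -> set T -> Prop) (S : set T)
    : set T :=
  smallest (near_closed d) S.

(* When [d] is separated, [cluster d] is the underlying set of the Smirnov
   compactification of [(X, d)]. *)
Record cluster (X : Type) (d : proximity X) := Cluster {
  cluster_mem :> set X -> Prop;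
  cluster_near : forall A B, cluster_mem A -> cluster_mem B -> d A B;
  cluster_max : forall A, (forall B, cluster_mem B -> d A B) -> cluster_mem A;
  cluster_setU : forall A B,
    cluster_mem (A `|` B) -> cluster_mem A \/ cluster_mem B }.

Definition smirnov_near (X : Type) (d : proximity X)
    (S T : set (cluster d)) : Prop :=
  forall A C : set X,
    (forall s, S s -> s A) -> (forall s, T s -> s C) -> d A C.

Section ProximityFacts.
Variables (X : Type) (d : proximity X).
Implicit Types (A B C : set X) (x : X).

Lemma near_subr A B C : B `<=` C -> d A B -> d A C.
Proof. by move=> /setUidr <- dAB; apply/near_setU; left. Qed.

Lemma near_subl A B C : A `<=` B -> d A C -> d B C.
Proof. by move=> AB /near_sym dCA; apply/near_sym/(near_subr AB). Qed.

Lemma near_set1 A x : A x -> d A [set x].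
Proof. by move=> Ax; apply: near_setI; apply/eqP/set0P; exists x. Qed.

Lemma point_cluster_near x A B : d A [set x] -> d B [set x] -> d A B.
Proof.
move=> dAx dBx; apply: contrapT => /near_strong [E [nAE nEB]].
have [Ex|nEx] := pselect (E x).
  by apply/nAE/(near_subr _ dAx) => _ ->.
by apply/nEB/near_sym/(near_subr _ dBx) => _ ->.
Qed.

Lemma point_cluster_max x A :
  (forall B, d B [set x] -> d A B) -> d A [set x].
Proof. by apply; apply: near_set1. Qed.

Lemma point_cluster_setU x A B :
  d (A `|` B) [set x] -> d A [set x] \/ d B [set x].
Proof. by move=> /near_sym/near_setU [] /near_sym; [left|right]. Qed.

Definition point_cluster x : cluster d :=
  @Cluster X d [set A | d A [set x]] (@point_cluster_near x)
    (@point_cluster_max x) (@point_cluster_setU x).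

Lemma point_cluster_unique x (s : cluster d) :
  s [set x] <-> s = point_cluster x.
Proof.
split=> [sx|->]; last exact: near_set1.
have E : cluster_mem s = cluster_mem (point_cluster x).
  apply/seteqP; split=> A /= sA; first exact: (cluster_near sA sx).
  apply: cluster_max => B sB.
  exact: (point_cluster_near sA (cluster_near sB sx)).
case: s (point_cluster x) E {sx} => [s p1 p2 p3] [t q1 q2 q3] /= E.
by case: _ / E in q1 q2 q3 *; congr Cluster; apply: Prop_irrelevance.
Qed.

Definition smirnov_closure A : set (cluster d) :=
  near_closure (@smirnov_near X d) (point_cluster @` A).

Lemma smirnov_closureE A : smirnov_closure A = [set s | s A].
Proof.
apply/seteqP; split=> s /=.
  move=> /(_ [set t | cluster_mem t A]); apply.
  split=> [t|_ [x Ax <-]]; last exact: near_set1.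
  move=> dAt; apply: cluster_max => B tB.
  by apply: dAt => // _ ->.
move=> sA F [Fcl AF]; apply: Fcl => D C FD /(_ s erefl) sC.
apply: contrapT => /near_strong [E [nDE nEC]]; apply: nEC.
apply: near_subl (cluster_near sA sC) => x Ax Ex; apply: nDE.
have := FD _ (AF _ (ex_intro2 _ _ x Ax erefl)).
by apply: near_subr => _ ->.
Qed.

End ProximityFacts.

Arguments point_cluster {X} d x.
Arguments smirnov_closure {X} d A.

Section DiscreteExtension.
Variables (X : Type) (Bd : bornology X) (b : coarse_proximity Bd).
Implicit Types A B C : set X.

Definition discrete_near A B : Prop := A `&` B <> set0 \/ b A B.

Lemma discrete_near_sym A B : discrete_near A B -> discrete_near B A.
Proof. by case=> [|/coarse_sym]; [rewrite setIC; left|right]. Qed.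

Lemma discrete_near_neq0 A B : discrete_near A B -> A <> set0 /\ B <> set0.
Proof.
case=> [AB0|/coarse_unbounded [nA nB]].
  by split=> E; apply: AB0; rewrite E ?set0I ?setI0.
by split=> E; [apply: nA|apply: nB]; rewrite E; apply: bounded_set0.
Qed.

Lemma discrete_near_setI A B : A `&` B <> set0 -> discrete_near A B.
Proof. by left. Qed.

Lemma discrete_near_setU A B C :
  discrete_near A (B `|` C) <-> discrete_near A B \/ discrete_near A C.
Proof.
have bU : b A (B `|` C) <-> b A B \/ b A C.
  split=> [/coarse_sym/coarse_setU [] /coarse_sym|[] /coarse_sym ?].
  - by left.
  - by right.
  - by apply/coarse_sym/coarse_setU; left.
  - by apply/coarse_sym/coarse_setU; right.
have iU : A `&` (B `|` C) <> set0 <-> A `&` B <> set0 \/ A `&` C <> set0.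
  rewrite setIUr; split=> [ABC|[] + E].
  - apply: contrapT => /not_orP [/contrapT AB /contrapT AC].
    by apply: ABC; rewrite AB AC setU0.
  - by move: E; rewrite setU_eq0 => -[].
  - by move: E; rewrite setU_eq0 => -[].
by rewrite /discrete_near; tauto.
Qed.

Lemma discrete_near_strong A B : ~ discrete_near A B ->
  exists E, ~ discrete_near A E /\ ~ discrete_near (~` E) B.
Proof.
move=> /not_orP [/contrapT AB nAB].
have AB0 x : A x -> B x -> False by move=> Ax Bx; have : set0 x by rewrite -AB.
have [E [nAE nEB]] := coarse_strong nAB.
exists ((E `\` A) `|` B); split.
- case=> [/eqP/set0P [x [Ax [[_ nAx]|Bx]]]|/coarse_sym/coarse_setU []].
  + exact: nAx.
  + exact: AB0 Ax Bx.
  + move=> h; apply/nAE/coarse_sym; rewrite -(setUidr (@subDsetl _ E A)).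
    by apply/coarse_setU; left.
  + by move/coarse_sym.
- case=> [/eqP/set0P [x [nEx Bx]]|h]; first by apply: nEx; right.
  have : b (~` E `|` A) B.
    have sub : ~` (E `\` A `|` B) `<=` ~` E `|` A.
      move=> x nx; have [Ax|nAx] := pselect (A x); first by right.
      by left=> Ex; apply: nx; left.
    by rewrite -(setUidr sub); apply/coarse_setU; left.
  by case/coarse_setU.
Qed.

Definition discrete_extension : proximity X :=
  Proximity discrete_near_sym discrete_near_neq0 discrete_near_setI
    discrete_near_setU discrete_near_strong.

Lemma discrete_extension_separated : separated discrete_extension.
Proof.
move=> x y; split=> [[/eqP/set0P [z [-> ->]] //|]|->].
  by move=> /coarse_unbounded [+ _] => /(_ (bounded_set1 _ _)).
exact: near_set1.
Qed.

Definition boundary : set (cluster discrete_extension) :=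
  [set s | forall A, s A -> ~ Bd A].

Definition trace A : set (cluster discrete_extension) :=
  smirnov_closure discrete_extension A `&` boundary.

End DiscreteExtension.

Arguments discrete_extension {X Bd} b.
Arguments boundary {X Bd} b.
Arguments trace {X Bd} b A.

(* Main.v *)
Require Import Defs.
From mathcomp Require Import all_boot.
From mathcomp Require Import boolp classical_sets filter.

(** By [smirnov_closureE], [trace b A] consists of the clusters without bounded
    members that contain [A]. The relation [weak_asymptotic_resemblance] is the
    conjunction of two mirror-image conditions, and each of them is the
    inclusion of one trace in the other ([trace_subP]), so that together they
    give the equality.

    Suppose that every unbounded part of [A] is near [B], and let [s] be a
    boundary cluster containing [A] but not [B]. Then some member of [s] is far
    from [B], and cutting [A] along a set that separates the two leaves a part
    of [A] that is in [s] and far from [B] ([cluster_far_part]). This part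
    is unbounded because [s] is in the boundary, a contradiction.

    Conversely, boundary clusters detect unboundedness: every unbounded set
    belongs to one of them ([unbounded_in_boundary]), namely to the cluster of
    an ultrafilter that contains the set and the complements of all bounded
    sets. If [A'] is an unbounded part of [A], either it meets [B] in an
    unbounded set and is near [B] at once, or [A' `\` B] is unbounded and lies
    in a boundary cluster, which contains [A], hence [B]; so [A' `\` B] is near
    [B] in the discrete extension, and being disjoint from [B] it is near [B] in
    [b]. *)

Set Implicit Arguments.
Unset Strict Implicit.
Unset Printing Implicit Defensive.
Local Open Scope classical_set_scope.

Section Clusters.
Variables (X : Type) (d : proximity X).
Implicit Types (A B C D : set X) (s : cluster d).

Lemma cluster_sub s A B : A `<=` B -> s A -> s B.
Proof.
move=> AB sA; apply: cluster_max => C sC.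
exact: near_subl AB (cluster_near sA sC).
Qed.

(** Maximality gives a member [C] of [s] far from [B], and the strong axiom a
    set [E] that separates them. As [E] is far from [C], the part of [A] inside
    [E] is not in [s]; so the part outside [E] is. *)
Lemma cluster_far_part s A B : s A -> ~ s B ->
  exists2 A', A' `<=` A & s A' /\ ~ d A' B.
Proof.
move=> sA nsB.
have [C sC nBC] : exists2 C, s C & ~ d B C.
  apply: contrapT => h; apply: nsB; apply: cluster_max => C sC.
  by apply: contrapT => nBC; apply: h; exists C.
have [E [nCE nEB]] : exists E, ~ d C E /\ ~ d (~` E) B.
  by apply: near_strong => /near_sym.
exists (A `\` E); first exact: subDsetl.
split; last by move=> /(near_subl (fun x => @proj2 _ _)).
move: sA; rewrite -{1}(setUIDK A E) => /cluster_setU [sAE|//].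
by case: nCE; apply: near_subr (cluster_near sC sAE); apply: subIsetr.
Qed.

Section UltrafilterCluster.
Variables (U : set_system X) (UU : UltraFilter U).

(** For an ultrafilter [U], this is the only cluster containing [U]: the limit of
    [U] in the Smirnov compactification when [d] is separated. *)
Definition near_all : set (set X) := [set A | forall D, U D -> d A D].

Lemma ultra_near_all A : U A -> near_all A.
Proof.
move=> UA D UD; apply: near_setI.
by apply/eqP/set0P; apply: filter_ex (filterI UA UD).
Qed.

(** Of a set [E] separating two far sets and its complement, one belongs to
    [U]. *)
Lemma near_all_near A B : near_all A -> near_all B -> d A B.
Proof.
move=> UA UB; apply: contrapT => /near_strong [E [nAE nEB]].
have [/UA//|/UB/near_sym//] := in_ultra_setVsetC E UU.
Qed.

Lemma near_all_max A : (forall B, near_all B -> d A B) -> near_all A.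
Proof. by move=> dA D UD; apply/dA/ultra_near_all. Qed.

Lemma near_all_setU A B : near_all (A `|` B) -> near_all A \/ near_all B.
Proof.
move=> UAB; apply: contrapT => /not_orP [nA nB].
move: nA => /existsNP [P /not_implyP [UP nAP]].
move: nB => /existsNP [Q /not_implyP [UQ nBQ]].
have UPQ : U (P `&` Q) by apply: filterI.
have /near_sym/near_setU [] := UAB _ UPQ => /near_sym.
  by move=> /(near_subr (@subIsetl _ P Q)).
by move=> /(near_subr (@subIsetr _ P Q)).
Qed.

Definition ultra_cluster : cluster d :=
  Cluster near_all_near near_all_max near_all_setU.

End UltrafilterCluster.

End Clusters.

Section Traces.
Variables (X : Type) (Bd : bornology X) (b : coarse_proximity Bd).
Implicit Types A B C : set X.

Lemma unbounded_setID A B : ~ Bd A -> ~ Bd (A `&` B) \/ ~ Bd (A `\` B).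
Proof.
move=> nA; apply: contrapT => /not_orP [/contrapT AB /contrapT A_B].
by apply: nA; rewrite -(setUIDK A B); apply: bounded_setU.
Qed.

(** This is the filter generated by [A] and the complements of bounded sets. *)
Lemma cobounded_proper_filter A : ~ Bd A ->
  ProperFilter [set P | Bd (A `\` P)].
Proof.
move=> nA; constructor => /=; first by rewrite setD0.
constructor => [|P Q /= AP AQ|P Q PQ /=].
- by rewrite /= setDT; apply: bounded_set0.
- by rewrite setDIr; apply: bounded_setU.
- by apply: bounded_sub; apply: setDS.
Qed.

(** A bounded set [C] is far from its complement in the discrete extension, so
    an ultrafilter containing that complement has a cluster without [C]. *)
Lemma unbounded_in_boundary A : ~ Bd A ->
  exists2 s : cluster (discrete_extension b), boundary b s & s A.
Proof.
move=> /cobounded_proper_filter/ultraFilterLemma [U [UU AU]].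
exists (ultra_cluster _ UU).
  move=> C sC BdC.
  have UnC : U (~` C) by apply: AU; apply: bounded_sub BdC => x [_ /contrapT].
  by have [|/coarse_unbounded []//] := sC _ UnC; rewrite setICr.
by apply: ultra_near_all; apply: AU; rewrite /= setDv; apply: bounded_set0.
Qed.

Lemma traceE A : trace b A = [set s : cluster (discrete_extension b) | s A] `&` boundary b.
Proof. by rewrite /trace smirnov_closureE. Qed.

Lemma trace_subP A B :
  (forall A', A' `<=` A -> ~ Bd A' -> b A' B) <-> trace b A `<=` trace b B.
Proof.
rewrite !traceE; split=> [bAB s [/= sA bs]|AB A' A'A nA'].
  split=> //=; apply: contrapT => /(cluster_far_part sA) [A' A'A [sA' nA'B]].
  by apply: nA'B; right; apply: bAB A'A (bs _ sA').
have [/coarse_setI//|nA'B] := unbounded_setID B nA'.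
have [s bs sA'] := unbounded_in_boundary nA'B.
have sA : s A by apply: cluster_sub sA' => x [/A'A].
have [/= sB _] := AB s (conj sA bs).
have [|bA'B] := cluster_near sA' sB; first by rewrite setDKI.
by rewrite -(setUIDK A' B); apply/coarse_setU; right.
Qed.

End Traces.

Theorem proposition4p8 (X : Type) (Bd : bornology X)
    (b : coarse_proximity Bd) (A B : set X) :
  weak_asymptotic_resemblance b A B <-> trace b A = trace b B.
Proof.
have BA : (forall B', B' `<=` B -> ~ Bd B' -> b A B') <->
    trace b B `<=` trace b A.
  rewrite -trace_subP.
  by split=> h B' B'B nB'; apply: coarse_sym; apply: h.
split=> [[/BA sBA /trace_subP sAB]|trAB]; first exact/seteqP.
by split; [apply/BA|apply/trace_subP]; rewrite trAB.
Qed.
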